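(* Fix a nodal displacement vector $\mathbf{u}\in\mathcal{U}^m_a$ and let $\mathbf{c}_u=\mathbf{c}(\mathbf{u})\in\mathbb{R}^n$, $\mathbf{a}\in\mathbb{R}^n$, $V_c>0$, and the functions $P_u$, $\Lambda$, $\Psi$, $\Psi^*$, $\Phi$, $\Xi$, $\Phi^d$ be as in the context. If $(\bar{\boldsymbol\rho},\bar{\boldsymbol\zeta})\in\mathbb{R}^n\times\mathbb{R}^{n+1}$ is a KKT point of $\Xi$, then $\bar{\boldsymbol\rho}$ is a KKT point of $\Phi$, $\bar{\boldsymbol\zeta}$ is a KKT point of $\Phi^d$, and $$\Phi(\bar{\boldsymbol\rho})=\Xi(\bar{\boldsymbol\rho},\bar{\boldsymbol\zeta})=\Phi^d(\bar{\boldsymbol\zeta}).$$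
   Context: Setting (finite element topology optimization): a design domain is divided into $n$ finite elements $\Omega_e$; $\mathbf{a}=(a_1,\dots,a_n)$ with $a_e=\mathrm{Vol}(\Omega_e)>0$; $V_c>0$ is the desired volume; $\mathcal{U}^m_a\subset\mathbb{R}^m$ is the admissible nodal displacement space. For a given $\mathbf{u}\in\mathcal{U}^m_a$, $\mathbf{c}_u=\mathbf{c}(\mathbf{u})\in\mathbb{R}^n$ is the vector of element energies $c_e(\mathbf{u})=\int_{\Omega_e}W(\nabla\mathbf{N}(\mathbf{x})\mathbf{u}_e)\,d\Omega$ (with $W$ the stored energy density, $\mathbf{N}$ the interpolation matrix, $\mathbf{u}_e$ the element nodal displacements); these are nonnegative. Define $P_u(\boldsymbol\rho)=-\mathbf{c}_u^T\boldsymbol\rho$ for $\boldsymbol\rho\in\mathbb{R}^n$. Let $\circ$ denote the componentwise (Hadamard) product and define the canonical measure $\Lambda(\boldsymbol\rho)=(\boldsymbol\rho\circ\boldsymbol\rho-\boldsymbol\rho,\ \boldsymbol\rho^T\mathbf{a}-V_c)\in\mathbb{R}^{n+1}$. Let $\mathcal{E}_a=\{(\boldsymbol\epsilon,\nu)\in\mathbb{R}^{n+1}:\boldsymbol\epsilon\le 0,\nu\le 0\}$ and $\Psi$ its indicator function ($0$ on $\mathcal{E}_a$, $+\infty$ otherwise); its Fenchel conjugate $\Psi^*$ is the indicator of $\mathcal{E}_a^*=\{\boldsymbol\zeta=(\boldsymbol\sigma,\varsigma)\in\mathbb{R}^{n+1}:\boldsymbol\sigma\ge0,\varsigma\ge0\}$.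 Define $\Phi(\boldsymbol\rho)=P_u(\boldsymbol\rho)+\Psi(\Lambda(\boldsymbol\rho))$, the total complementary function $\Xi(\boldsymbol\rho,\boldsymbol\zeta)=P_u(\boldsymbol\rho)+\Lambda(\boldsymbol\rho)^T\boldsymbol\zeta-\Psi^*(\boldsymbol\zeta)$, and the canonical dual function $\Phi^d(\boldsymbol\zeta)=P^\Lambda_u(\boldsymbol\zeta)-\Psi^*(\boldsymbol\zeta)$, where $P^\Lambda_u(\boldsymbol\zeta)$ is the stationary value of $\boldsymbol\rho\mapsto\Lambda(\boldsymbol\rho)^T\boldsymbol\zeta+P_u(\boldsymbol\rho)$, namely $P^\Lambda_u(\boldsymbol\zeta)=-\frac14\boldsymbol\tau_u(\boldsymbol\zeta)^T\mathbf{G}(\boldsymbol\zeta)^{-1}\boldsymbol\tau_u(\boldsymbol\zeta)-\varsigma V_c$ with $\mathbf{G}(\boldsymbol\zeta)=\mathrm{Diag}(\boldsymbol\sigma)$ and $\boldsymbol\tau_u(\boldsymbol\zeta)=\boldsymbol\sigma-\varsigma\mathbf{a}+\mathbf{c}_u$ (defined when $\det\mathbf{G}\ne0$). KKT points are understood in the sense of the Karush–Kuhn–Tucker conditions for the constraints $\boldsymbol\rho\circ\boldsymbol\rho-\boldsymbol\rho\le0$, $\boldsymbol\rho^T\mathbf{a}-V_c\le0$ with multiplier $\boldsymbol\zeta=(\boldsymbol\sigma,\varsigma)\in\mathcal{E}_a^*$ (i.e. stationarity together with $\boldsymbol\sigma\ge0$, $\varsigma\ge0$, primal feasibility, and complementarity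 $\boldsymbol\sigma^T(\boldsymbol\rho\circ\boldsymbol\rho-\boldsymbol\rho)=0$, $\varsigma(\boldsymbol\rho^T\mathbf{a}-V_c)=0$).
   Formalization: The conclusion that ζ̄ is a KKT point of Φ^d is stated under the condition det G(ζ̄) ≠ 0, since Φ^d is defined only there and a KKT point of Ξ may have some σ_e = 0; the other conclusions are unconditional. *)

(* Defs.v *)
From HB Require Import structures.
From mathcomp Require Import all_boot all_order all_algebra.
From mathcomp Require Import all_classical all_reals all_analysis.
From mathcomp Require Import ring lra.

Set Implicit Arguments.
Unset Strict Implicit.
Unset Printing Implicit Defensive.

Import Order.TTheory GRing.Theory Num.Theory.
Import numFieldNormedType.Exports.

Local Open Scope classical_set_scope.
Local Open Scope ring_scope.

(* R^d with its Borel sigma-algebra. *)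
Definition borel_rV (R : realType) (d : nat) :=
  g_sigma_algebraType (@open 'rV[R]_d).

(* The d-dimensional Lebesgue measure is characterised by its values on boxes. *)
Definition is_lebesgue_rV (R : realType) (d : nat)
    (mu : set (borel_rV R d) -> \bar R) : Prop :=
  forall lo hi : 'rV[R]_d, (forall i, lo 0 i <= hi 0 i) ->
    mu [set x : 'rV[R]_d | forall i, lo 0 i <= x 0 i <= hi 0 i] =
    (\prod_i (hi 0 i - lo 0 i))%:E.

Definition elt_dofs (R : realType) (m p : nat) (dof : 'I_p -> 'I_m)
  (u : 'cV[R]_m) : 'cV[R]_p := \col_j u (dof j) 0.

Definition disp_field (R : realType) (d m p : nat)
    (N : 'rV[R]_d -> 'M[R]_(d, p)) (dof : 'I_p -> 'I_m) (u : 'cV[R]_m)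
    (x : 'rV[R]_d) : 'rV[R]_d :=
  (N x *m elt_dofs dof u)^T.

(* The (i, j) entry is d_j u_i; the library's Jacobian acts on row vectors,
   whence the transpose. *)
Definition disp_grad (R : realType) (d m p : nat)
    (N : 'rV[R]_d -> 'M[R]_(d, p)) (dof : 'I_p -> 'I_m) (u : 'cV[R]_m)
    (x : 'rV[R]_d) : 'M[R]_d :=
  (jacobian (disp_field N dof u) x)^T.

Record fe_model (R : realType) (d m n : nat) := FEModel {
  fe_vol : {measure set (borel_rV R d) -> \bar R} ;
  fe_vol_lebesgue : is_lebesgue_rV fe_vol ;
  fe_domain : set (borel_rV R d) ;
  fe_elt : 'I_n -> set (borel_rV R d) ;
  fe_elt_measurable : forall e, measurable (fe_elt e) ;
  fe_domainE : fe_domain = \bigcup_e fe_elt e ;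
  fe_elt_disj : forall e f, e != f -> fe_vol (fe_elt e `&` fe_elt f) = 0%E ;
  fe_elt_vol : forall e, (0 < fe_vol (fe_elt e) < +oo)%E ;
  fe_ndof : 'I_n -> nat ;
  fe_dof : forall e, 'I_(fe_ndof e) -> 'I_m ;
  fe_N : forall e, 'rV[R]_d -> 'M[R]_(d, fe_ndof e) ;
  fe_N_diff : forall e, {ae fe_vol, forall x,
    fe_elt e x -> differentiable (@fe_N e) (x : 'rV[R]_d)} ;
  fe_W : 'M[R]_d -> R ;
  fe_W_ge0 : forall F, 0 <= fe_W F ;
  fe_adm : set 'cV[R]_m ;
  fe_energy_integrable : forall u e, fe_adm u ->
    fe_vol.-integrable (fe_elt e)
      (fun x => (fe_W (disp_grad (@fe_N e) (@fe_dof e) u x))%:E)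
}.

Section FiniteElementData.
Context {R : realType} {d m n : nat} (M : fe_model R d m n).

Definition fe_a : 'rV[R]_n := \row_e fine (fe_vol M (fe_elt M e)).

Definition fe_c (u : 'cV[R]_m) : 'rV[R]_n :=
  \row_e \int[fe_vol M]_(x in fe_elt M e)
    fe_W M (disp_grad (@fe_N _ _ _ _ M e) (@fe_dof _ _ _ _ M e) u x).

Lemma fe_a_gt0 e : 0 < fe_a 0 e.
Proof. by rewrite mxE fine_gt0// fe_elt_vol. Qed.

Lemma fe_c_ge0 u e : 0 <= fe_c u 0 e.
Proof. by rewrite mxE; apply: Rintegral_ge0 => x _; exact: fe_W_ge0. Qed.

End FiniteElementData.

Section Stationarity.
Context {R : realType} {V : normedModType R}.

Definition stationary (f : V -> R) (x : V) : Prop :=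
  differentiable f x /\ forall h, 'd f x h = 0.

(* Unspecified when f has no stationary point. *)
Definition stationary_value (f : V -> R) : R :=
  get [set v | exists2 x, stationary f x & v = f x].

(* Karush-Kuhn-Tucker point of: minimize f subject to g i <= 0 for all i. *)
Definition KKT_point (I : finType) (f : V -> R) (g : I -> V -> R) (x : V) :=
  exists mu : I -> R,
    [/\ differentiable f x /\ (forall i, differentiable (g i) x),
        (forall h, 'd f x h + \sum_i mu i * 'd (g i) x h = 0),
        (forall i, 0 <= mu i),
        (forall i, g i x <= 0)
      & (forall i, mu i * g i x = 0)].

End Stationarity.

Section CanonicalDuality.
Context {R : realType} {n : nat}.

Definition dotv (x y : 'rV[R]_n) : R := \sum_e x 0 e * y 0 e.

Definition hadamard (x y : 'rV[R]_n) : 'rV[R]_n := \row_e (x 0 e * y 0 e).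

(* R^(n+1), split as (epsilon, nu) or (sigma, varsigma). *)
Local Notation canon := ('rV[R]_n * R)%type.

Definition pairing (xi zeta : canon) : R := dotv xi.1 zeta.1 + xi.2 * zeta.2.

Definition canon_coord (xi : canon) (i : option 'I_n) : R :=
  if i is Some e then xi.1 0 e else xi.2.

Definition Ea : set canon :=
  [set xi : canon | (forall e, xi.1 0 e <= 0) /\ xi.2 <= 0].

Definition Ea_star : set canon :=
  [set zeta : canon | (forall e, 0 <= zeta.1 0 e) /\ 0 <= zeta.2].

Definition indicator (A : set canon) (xi : canon) : \bar R :=
  if xi \in A then 0%E else +oo%E.

Definition fenchel_conj (f : canon -> \bar R) (zeta : canon) : \bar R :=
  ereal_sup [set ((pairing xi zeta)%:E - f xi)%E | xi in setT].

Definition Psi : canon -> \bar R := indicator Ea.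

Definition Psi_star : canon -> \bar R := fenchel_conj Psi.

Definition Gmx (zeta : canon) : 'M[R]_n := diag_mx zeta.1.

Variables (c a : 'rV[R]_n) (Vc : R).

Definition Pu (rho : 'rV[R]_n) : R := - dotv c rho.

Definition Lam (rho : 'rV[R]_n) : canon :=
  (hadamard rho rho - rho, dotv rho a - Vc).

Definition Phi (rho : 'rV[R]_n) : \bar R := ((Pu rho)%:E + Psi (Lam rho))%E.

Definition lagr (zeta : canon) (rho : 'rV[R]_n) : R :=
  Pu rho + pairing (Lam rho) zeta.

Definition Xi (rho : 'rV[R]_n) (zeta : canon) : \bar R :=
  ((lagr zeta rho)%:E - Psi_star zeta)%E.

Definition tau (zeta : canon) : 'rV[R]_n := zeta.1 - zeta.2 *: a + c.

Definition PLam (zeta : canon) : R := stationary_value (lagr zeta).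

Definition Phid (zeta : canon) : \bar R := ((PLam zeta)%:E - Psi_star zeta)%E.

Definition KKT_Xi (rho : 'rV[R]_n) (zeta : canon) : Prop :=
  [/\ stationary (lagr zeta) rho,
      Ea_star zeta,
      Ea (Lam rho),
      dotv zeta.1 (hadamard rho rho - rho) = 0
    & zeta.2 * (dotv rho a - Vc) = 0].

Definition KKT_Phi (rho : 'rV[R]_n) : Prop :=
  KKT_point Pu (fun i r => canon_coord (Lam r) i) rho.

(* Phid equals PLam on Ea_star and -oo elsewhere, so its KKT points are those
   of: maximize PLam(zeta) subject to zeta >= 0. *)
Definition KKT_Phid (zeta : canon) : Prop :=
  KKT_point (fun z => - PLam z) (fun i z => - canon_coord z i) zeta.

End CanonicalDuality.

Section ClosedForms.
Context {R : realType} {n : nat}.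
Variables (c a : 'rV[R]_n) (Vc : R).
Local Notation canon := ('rV[R]_n * R)%type.

Lemma is_diff_coord (r : 'rV[R]_n) e :
  is_diff r (fun x : 'rV[R]_n => x 0 e) (fun h => h 0 e).
Proof.
have L : linear (fun x : 'rV[R]_n => x 0 e : R) by move=> k x y; rewrite !mxE.
pose f : {linear 'rV[R]_n -> R} := HB.pack (fun x : 'rV[R]_n => x 0 e : R)
  (GRing.isLinear.Build _ _ _ _ (fun x : 'rV[R]_n => x 0 e : R) L).
have C : continuous f by exact: coord_continuous.
apply: DiffDef; first exact: (linear_differentiable (f := f)).
exact: (diff_lin (f := f)).
Qed.

Lemma is_diff_sum (V : normedModType R) k (f df : 'I_k -> V -> R) x :
  (forall i, is_diff x (f i) (df i)) ->
  is_diff x (fun y => \sum_i f i y) (fun h => \sum_i df i h).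
Proof.
move=> H; elim: k f df H => [|k IH] f df H.
  have -> : (fun y => \sum_(i < 0) f i y) = cst 0 by apply/funext => y; rewrite big_ord0.
  have -> : (fun y => \sum_(i < 0) df i y) = 0 by apply/funext => y; rewrite big_ord0.
  exact: is_diff_cst.
have -> : (fun y => \sum_(i < k.+1) f i y) =
   (fun y => \sum_(i < k) f (widen_ord (leqnSn k) i) y) + f ord_max.
  by apply/funext => y; rewrite big_ord_recr.
have -> : (fun y => \sum_(i < k.+1) df i y) =
   (fun y => \sum_(i < k) df (widen_ord (leqnSn k) i) y) + df ord_max.
  by apply/funext => y; rewrite big_ord_recr.
apply: is_diffD; exact: IH.
Qed.

Definition glagr (z : canon) (r h : 'rV[R]_n) : R :=
 \sum_e (2 * z.1 0 e * r 0 e - tau c a z 0 e) * h 0 e.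

Lemma lagrE (z : canon) r : lagr c a Vc z r =
  (\sum_e (z.1 0 e * r 0 e * r 0 e - tau c a z 0 e * r 0 e)) - z.2 * Vc.
Proof.
rewrite /lagr /Pu /pairing /Lam /dotv /= mulrBl [Vc * _]mulrC !addrA; congr (_ - _).
rewrite -sumrN mulr_suml -!big_split /=; apply: eq_bigr => e _.
rewrite /tau !mxE; ring.
Qed.

Lemma is_diff_lagr (z : canon) r : is_diff r (lagr c a Vc z) (glagr z r).
Proof.
have -> : lagr c a Vc z = (fun y : 'rV[R]_n => \sum_e (z.1 0 e * y 0 e * y 0 e - tau c a z 0 e * y 0 e))
    + cst (- (z.2 * Vc)).
  by apply/funext => y; rewrite lagrE.
apply: (@is_diff_eq _ _ _ _ (glagr z r + 0)); last by rewrite addr0.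
apply: is_diffD; apply: is_diff_sum => e.
have K := is_diff_coord r e.
have -> : (fun y : 'rV[R]_n => z.1 0 e * y 0 e * y 0 e - tau c a z 0 e * y 0 e) =
  z.1 0 e *: ((fun y : 'rV[R]_n => y 0 e) * (fun y : 'rV[R]_n => y 0 e))
  - tau c a z 0 e *: (fun y : 'rV[R]_n => y 0 e).
  by apply/funext => y; rewrite /= -mulrA.
apply: is_diff_eq; apply/funext => h /=.
rewrite !fctE /GRing.scale /=; ring.
Qed.

Lemma stat_lagr (z : canon) r : stationary (lagr c a Vc z) r <->
  forall e, 2 * z.1 0 e * r 0 e = tau c a z 0 e.
Proof.
have D := is_diff_lagr z r.
split=> [[_ H] e|H].
  have /= := H (delta_mx 0 e); rewrite (@diff_val _ _ _ _ _ _ _ D) /glagr.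
  rewrite (bigD1 e)//= big1 => [|i ie]; last by rewrite [delta_mx _ _ _ _]mxE (negbTE ie) andbF mulr0.
  by rewrite addr0 [delta_mx _ _ _ _]mxE !eqxx mulr1 => /eqP; rewrite subr_eq0 => /eqP.
split=> [|h]; first exact: ex_diff.
rewrite (@diff_val _ _ _ _ _ _ _ D) /glagr big1// => e _.
by rewrite H subrr mul0r.
Qed.

Lemma stat_val (z : canon) r : stationary (lagr c a Vc z) r ->
  PLam c a Vc z = lagr c a Vc z r.
Proof.
move=> S; rewrite /PLam /stationary_value.
set A := [set _ | _].
have : A (lagr c a Vc z r) by exists r.
move=> /getI [] s /stat_lagr Hs ->.
move/stat_lagr: S => S.
rewrite !lagrE; congr (_ - _); apply: eq_bigr => e _.
have E : z.1 0 e * (s 0 e - r 0 e) = 0.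
  have := S e; rewrite -(Hs e); lra.
have F : z.1 0 e * (s 0 e - r 0 e) * (s 0 e - r 0 e) = 0 by rewrite E mul0r.
rewrite -(S e); lra.
Qed.

(* The closed form of the stationary value on the domain det G(zeta) <> 0. *)
Lemma PLamE (z : canon) : \det (Gmx z) != 0 ->
  PLam c a Vc z =
    - 4%:R^-1 * (tau c a z *m invmx (Gmx z) *m (tau c a z)^T) 0 0 - z.2 * Vc.
Proof.
rewrite /Gmx det_diag => /prodf_neq0 H.
have H' e : z.1 0 e != 0 by exact: H.
have I : invmx (diag_mx z.1) = diag_mx (\row_e (z.1 0 e)^-1).
  have V : diag_mx z.1 *m diag_mx (\row_e (z.1 0 e)^-1) = 1%:M.
    rewrite mulmx_diag; apply/matrixP => i j; rewrite !mxE.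
    by have [->|] := eqVneq; rewrite ?mulr1n ?mulr0n// mulfV.
  have [U _] := mulmx1_unit V.
  by rewrite -[RHS]mul1mx -(mulVmx U) -mulmxA V mulmx1.
rewrite (@stat_val _ (\row_e (tau c a z 0 e / (2 * z.1 0 e)))); last first.
  by apply/stat_lagr => e; rewrite mxE; have := H' e; move: (z.1 0 e) => x x0; field.
rewrite lagrE; congr (_ - _); rewrite I mxE big_distrr/=; apply: eq_bigr => e _.
rewrite mul_mx_diag !mxE; have := H' e; move: (z.1 0 e) => x x0.
by field.
Qed.

Lemma Psi_starE : @Psi_star R n = indicator Ea_star.
Proof.
apply/funext => z; rewrite /Psi_star /fenchel_conj /indicator.
case: ifPn => [|].
  rewrite inE => -[z1 z2]; apply/eqP; rewrite eq_le; apply/andP; split.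
    apply: ge_ereal_sup => _ [xi _ <-]; rewrite /Psi /indicator; case: ifPn.
      rewrite inE => -[x1 x2]; rewrite sube0 lee_fin /pairing.
      rewrite -[leRHS]addr0; apply: lerD; last exact: mulr_le0_ge0.
      by apply: sumr_le0 => e _; exact: mulr_le0_ge0.
    by move=> _; rewrite /= leNye.
  apply: ereal_sup_ubound; exists 0 => //; rewrite /Psi /indicator.
  have -> : (0 : canon) \in Ea by rewrite inE; split=> [e|] /=; rewrite ?mxE.
  by rewrite sube0 /pairing /dotv mul0r big1 ?addr0 // => e _; rewrite mxE mul0r.
move=> /negP nz.
have [xi xiE xz] : exists2 xi : canon, Ea xi & 0 < pairing xi z.
  have [[e ze]|] := pselect (exists e, z.1 0 e < 0).
    exists (- delta_mx 0 e, 0).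
      split=> [i|] //=; rewrite !mxE oppr_le0; case: (_ && _) => //; exact: ler01.
    rewrite /pairing /= mul0r addr0 /dotv (bigD1 e)//= big1 => [|i ie].
      by rewrite !mxE !eqxx addr0 mulN1r oppr_gt0.
    by rewrite !mxE (negbTE ie) andbF oppr0 mul0r.
  move=> /forallNP h; exists (0, -1).
    by split=> [i|] /=; rewrite ?mxE// oppr_le0.
  rewrite /pairing /= /dotv big1 => [|i _]; last by rewrite mxE mul0r.
  rewrite add0r mulN1r oppr_gt0 ltNge; apply/negP => z2; apply: nz; rewrite inE.
  by split=> // e; rewrite leNgt; apply/negP/h.
apply/eqyP => A A0; apply: le_ereal_sup_tmp.
pose k := A / pairing xi z; have k0 : 0 <= k by rewrite divr_ge0// ltW.
exists ((pairing (k *: xi) z)%:E - Psi (k *: xi))%E; first by exists (k *: xi).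
have kE : k *: xi \in Ea.
  case: xiE => x1 x2; rewrite inE; split=> [e|] /=; rewrite ?mxE;
    exact: mulr_ge0_le0.
have -> : pairing (k *: xi) z = k * pairing xi z.
  rewrite /pairing /dotv mulrDr mulrA mulr_sumr; congr (_ + _).
  by apply: eq_bigr => e _; rewrite /= mxE mulrA.
by rewrite /Psi /indicator kE sube0 /k divfK ?gt_eqF.
Qed.
End ClosedForms.

(* Main.v *)
(* The multipliers certifying the two KKT points are the data of the other
   problem: [zeta] for [Phi], and [- Lam rho] for [Phid].  The latter works
   because, by the envelope theorem, the differential of [PLam] at [zeta] is the
   pairing with [Lam rho].  Complementarity makes the pairing of [Lam rho] with
   [zeta] vanish, which equates the three values. *)

Require Import Defs.
From HB Require Import structures.
From mathcomp Require Import all_boot all_order all_algebra.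
From mathcomp Require Import all_classical all_reals all_analysis.
From mathcomp Require Import ring lra.

Import Order.TTheory GRing.Theory Num.Theory.
Import numFieldNormedType.Exports.

Local Open Scope classical_set_scope.
Local Open Scope ring_scope.

(** A differential depends only on the germ at [x]. This allows [PLam] to be differentiated through
    a closed form that is valid only near [zeta]. *)
Lemma is_diff_near_eq {R : realType} {V W : normedModType R}
    {f g df : V -> W} {x : V} :
  (\forall y \near x, f y = g y) -> is_diff x f df -> is_diff x g df.
Proof.
move=> fg [fdiff fval].
have [dfC dfE] := (diff_locallyP x f).1 fdiff.
have fgx : f x = g x by exact: nbhs_singleton fg.
have gE : g \o shift x = cst (g x) + 'd f x +o_ 0 id.
  apply/eqaddoP => e e0; move/eqaddoP: dfE => /(_ e e0) H.
  have : \forall h \near (0 : V), f (h + x) = g (h + x).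
    by rewrite (near_shift x)/=; near do rewrite /= sub0r addrNK.
  move=> fg0; near=> h.
  have <- : (f \o shift x - (cst (f x) + 'd f x)) h =
            (g \o shift x - (cst (g x) + 'd f x)) h.
    rewrite !fctE /= fgx; congr (_ - _); near: h; exact: fg0.
  by near: h; exact: H.
have gd : 'd g x = 'd f x :> (V -> W) by exact: diff_unique.
by apply: DiffDef; [apply/diff_locallyP; rewrite gd | rewrite gd].
Unshelve. all: by end_near. Qed.

Lemma is_diff_inv {R : realType} {V : normedModType R} {f df : V -> R} {x : V} :
  f x != 0 -> is_diff x f df ->
  is_diff x (fun y => (f y)^-1) (fun h => - (f x) ^- 2 * df h).
Proof.
move=> fx0 [fdiff <-]; apply: DiffDef; first exact: differentiableV.
by rewrite diffV.
Qed.

Lemma is_diff_fst {R : realType} {U V : normedModType R} (z : U * V) :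
  is_diff z (@fst U V) (@fst U V).
Proof.
have C : continuous (fst : U * V -> U) by move=> y; exact: cvg_fst.
apply: DiffDef; first exact: (linear_differentiable (f := fst)).
exact: (diff_lin (f := fst)).
Qed.

Lemma is_diff_snd {R : realType} {U V : normedModType R} (z : U * V) :
  is_diff z (@snd U V) (@snd U V).
Proof.
have C : continuous (snd : U * V -> V) by move=> y; exact: cvg_snd.
apply: DiffDef; first exact: (linear_differentiable (f := snd)).
exact: (diff_lin (f := snd)).
Qed.

Lemma is_diff_fst_coord {R : realType} {n : nat} (z : 'rV[R]_n * R) (e : 'I_n) :
  is_diff z (fun y : 'rV[R]_n * R => y.1 0 e) (fun h => h.1 0 e).
Proof. exact: is_diff_comp (is_diff_fst z) (is_diff_coord z.1 e). Qed.

(** Translates the sums over constraints in [KKT_point] into the pairing used by [lagr]; [None]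
    indexes the volume constraint. *)
Lemma sum_canon_coord {R : realType} {n : nat} (x y : 'rV[R]_n * R) :
  \sum_(i : option 'I_n) canon_coord x i * canon_coord y i = pairing x y.
Proof.
rewrite (bigD1 None)//= addrC; congr (_ + _).
rewrite (reindex_omap Some id) => [|[i|]//]; apply: eq_big => //= i.
by rewrite eqxx.
Qed.

Section Duality.
Context {R : realType} {n : nat}.
Variables (c a : 'rV[R]_n) (Vc : R).
Local Notation canon := ('rV[R]_n * R)%type.

(** The differential of [Lam] at [rho] applied to [h]. *)
Definition dLam (rho h : 'rV[R]_n) : canon :=
  (\row_e ((2 * rho 0 e - 1) * h 0 e), dotv h a).

Lemma is_diff_Pu (rho : 'rV[R]_n) : is_diff rho (Pu c) (fun h => - dotv c h).
Proof.
rewrite /Pu /dotv.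
have D : is_diff rho (fun r : 'rV[R]_n => \sum_e c 0 e * r 0 e)
                     (fun h => \sum_e c 0 e * h 0 e).
  apply: is_diff_sum => e; have K := is_diff_coord rho e.
  exact: (is_diffZ (c 0 e) K).
exact: (is_diffN D).
Qed.

Lemma is_diff_Lam_coord (rho : 'rV[R]_n) (i : option 'I_n) :
  is_diff rho (fun r => canon_coord (Lam a Vc r) i)
              (fun h => canon_coord (dLam rho h) i).
Proof.
case: i => [e|] /=.
  have K := is_diff_coord rho e.
  have -> : (fun r : 'rV[R]_n => (hadamard r r - r) 0 e) =
      (fun r : 'rV[R]_n => r 0 e) * (fun r : 'rV[R]_n => r 0 e)
      - (fun r : 'rV[R]_n => r 0 e).
    by apply/funext => r; rewrite !mxE.
  apply: is_diff_eq; apply/funext => h.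
  by rewrite !fctE mxE /GRing.scale /=; ring.
have D : is_diff rho (fun r : 'rV[R]_n => dotv r a) (fun h => dotv h a).
  apply: is_diff_sum => e; have K := is_diff_coord rho e.
  have -> : (fun r : 'rV[R]_n => r 0 e * a 0 e) =
      a 0 e *: (fun r : 'rV[R]_n => r 0 e).
    by apply/funext => r; exact: mulrC.
  exact: (is_diffZ (a 0 e) K).
have := is_diffB D (is_diff_cst Vc rho).
by move=> D'; apply: (is_diff_eq D'); rewrite subr0.
Qed.

(** Regroups the gradient of the Lagrangian by constraints, so that its vanishing is the multiplier
    equation for [Phi]. *)
Lemma glagr_dLam (zeta : canon) (rho h : 'rV[R]_n) :
  glagr c a zeta rho h = - dotv c h + pairing (dLam rho h) zeta.
Proof.
rewrite /glagr /pairing /dLam /dotv /= -sumrN mulr_suml addrA -!big_split /=.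
by apply: eq_bigr => e _; rewrite /tau !mxE; ring.
Qed.

Lemma PLam_sum (z : canon) : (forall e, z.1 0 e != 0) ->
  PLam c a Vc z =
    (\sum_e - 4^-1 * (tau c a z 0 e ^+ 2 * (z.1 0 e)^-1)) - z.2 * Vc.
Proof.
move=> z0.
(* The Lagrangian is separable: the witness is the critical point of each scalar quadratic $\sigma_e
   r^2 - \tau_e r$. *)
rewrite (@stat_val _ _ _ _ _ _ (\row_e (tau c a z 0 e / (2 * z.1 0 e)))).
  rewrite lagrE; congr (_ - _); apply: eq_bigr => e _; rewrite mxE.
  by have := z0 e; move: (z.1 0 e) => x x0; field.
by apply/stat_lagr => e; rewrite mxE; have := z0 e; move: (z.1 0 e) => x x0; field.
Qed.

Lemma is_diff_tau_coord (z : canon) (e : 'I_n) :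
  is_diff z (fun y => tau c a y 0 e) (fun h => h.1 0 e - h.2 * a 0 e).
Proof.
have K1 := is_diff_fst_coord z e.
have K2 : is_diff z (snd : canon -> R) snd := is_diff_snd z.
have -> : (fun y => tau c a y 0 e) =
    (fun y : canon => y.1 0 e) - a 0 e *: (snd : canon -> R) + cst (c 0 e).
  by apply/funext => y; rewrite /tau !mxE mulrC.
apply: is_diff_eq; apply/funext => h.
by rewrite !fctE /GRing.scale /= addr0 mulrC.
Qed.

(** A finite intersection of open conditions; it provides the neighbourhood on which [PLam_sum]
    applies. *)
Lemma near_coord_neq0 (z : canon) : (forall e, z.1 0 e != 0) ->
  \forall y \near z, forall e, (y : canon).1 0 e != 0.
Proof.
move=> z0; apply: (filter_forall (nbhs_filter z)) => e.
have [D _] := is_diff_fst_coord z e.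
have C : {for z, continuous (fun y : canon => y.1 0 e)}
  by exact: differentiable_continuous.
have : nbhs (z.1 0 e) [set t : R | t != 0].
  by apply: open_nbhs_nbhs; split => //=; exact: open_neq.
by move=> /C.
Qed.

(* Envelope theorem: only the explicit dependence of [lagr] on [zeta], which is
   affine, contributes to the differential of its stationary value. *)
Lemma is_diff_PLam (zeta : canon) (rho : 'rV[R]_n) :
  (forall e, zeta.1 0 e != 0) -> stationary (lagr c a Vc zeta) rho ->
  is_diff zeta (PLam c a Vc) (pairing (Lam a Vc rho)).
Proof.
move=> z0 /stat_lagr S.
pose T e (z : canon) := - 4^-1 * (tau c a z 0 e ^+ 2 * (z.1 0 e)^-1).
(* The quotient rule for $-\tau_e^2/(4\sigma_e)$, simplified by the stationarity relation $\tau_e =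
   2\sigma_e\rho_e$. *)
pose dT e (h : canon) :=
  (rho 0 e ^+ 2 - rho 0 e) * h.1 0 e + rho 0 e * a 0 e * h.2.
have TD e : is_diff zeta (T e) (dT e).
  have K1 := is_diff_tau_coord zeta e.
  have K2 := is_diff_inv (z0 e) (is_diff_fst_coord zeta e).
  have -> : T e = - 4^-1 *: ((fun y => tau c a y 0 e) *
      (fun y => tau c a y 0 e) * (fun y : canon => (y.1 0 e)^-1)).
    by apply/funext => y; rewrite /T expr2.
  apply: is_diff_eq; apply/funext => h.
  rewrite !fctE /dT /GRing.scale /= -(S e).
  by have := z0 e; move: (zeta.1 0 e) => x x0; field.
apply: (@is_diff_near_eq _ _ _ (fun z => (\sum_e T e z) - z.2 * Vc)).
  near=> y; apply/esym/PLam_sum; near: y; exact: near_coord_neq0.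
have D2 : is_diff zeta (fun z : canon => z.2 * Vc) (fun h => h.2 * Vc).
  have K2 : is_diff zeta (snd : canon -> R) snd := is_diff_snd zeta.
  have -> : (fun z : canon => z.2 * Vc) = Vc *: (snd : canon -> R).
    by apply/funext => y; exact: mulrC.
  exact: (is_diffZ Vc K2).
apply: (is_diff_eq (is_diffB (is_diff_sum TD) D2)); apply/funext => h.
rewrite !fctE /pairing /Lam /dotv /= mulrBl [Vc * _]mulrC addrA; congr (_ - _).
rewrite mulr_suml -big_split /=; apply: eq_bigr => e _.
by rewrite /dT !mxE; ring.
Unshelve. all: by end_near. Qed.

(* Each summand of the vanishing scalar product has the same sign. *)
Lemma KKT_Xi_slack (rho : 'rV[R]_n) (zeta : canon) (i : option 'I_n) :
  KKT_Xi c a Vc rho zeta ->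
  canon_coord zeta i * canon_coord (Lam a Vc rho) i = 0.
Proof.
move=> [_ [z1 z2] [L1 L2] s1 s2]; case: i => [e|]//=.
have /eqP := s1; rewrite /dotv -oppr_eq0 -sumrN psumr_eq0.
  by move=> /allP /(_ e (mem_index_enum _)) /=; rewrite oppr_eq0 => /eqP.
by move=> i _; rewrite oppr_ge0 mulr_ge0_le0.
Qed.

Lemma KKT_Xi_pairing (rho : 'rV[R]_n) (zeta : canon) :
  KKT_Xi c a Vc rho zeta -> pairing (Lam a Vc rho) zeta = 0.
Proof.
move=> K; rewrite -sum_canon_coord big1// => i _.
by rewrite mulrC KKT_Xi_slack.
Qed.

Lemma KKT_Xi_KKT_Phi (rho : 'rV[R]_n) (zeta : canon) :
  KKT_Xi c a Vc rho zeta -> KKT_Phi c a Vc rho.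
Proof.
move=> K; have [[_ S] [z1 z2] [L1 L2] _ _] := K.
have DP := is_diff_Pu rho; have DL := is_diff_Lam_coord rho.
exists (canon_coord zeta); split.
- by split=> [|i]; exact: ex_diff.
- move=> h; have := S h.
  rewrite (@diff_val _ _ _ _ _ _ _ (is_diff_lagr c a Vc zeta rho)) glagr_dLam.
  rewrite (@diff_val _ _ _ _ _ _ _ DP) -sum_canon_coord => Sh.
  rewrite -[RHS]Sh; congr (_ + _).
  by apply: eq_bigr => i _; rewrite (@diff_val _ _ _ _ _ _ _ (DL i)) mulrC.
- by case.
- by case.
- by move=> i; exact: KKT_Xi_slack.
Qed.

(** The two feasibility conditions exchange roles: that of [rho] makes the multipliers [- Lam rho]
    nonnegative, and [Ea_star zeta] is feasibility in the dual problem. *)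
Lemma KKT_Xi_KKT_Phid (rho : 'rV[R]_n) (zeta : canon) :
  \det (Gmx zeta) != 0 -> KKT_Xi c a Vc rho zeta -> KKT_Phid c a Vc zeta.
Proof.
rewrite /Gmx det_diag => /prodf_neq0 z0 K.
have [S [z1 z2] [L1 L2] _ _] := K.
have DP := is_diffN (is_diff_PLam zeta rho (fun e => z0 e isT) S).
have DC (i : option 'I_n) : is_diff zeta (fun z : canon => - canon_coord z i)
    (fun h => - canon_coord h i).
  case: i => [e|] /=; first exact: (is_diffN (is_diff_fst_coord zeta e)).
  exact: (is_diffN (is_diff_snd zeta)).
exists (fun i => - canon_coord (Lam a Vc rho) i); split.
- by split=> [|i]; exact: ex_diff.
- move=> h; rewrite (@diff_val _ _ _ _ _ _ _ DP) fctE -sum_canon_coord -sumrN.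
  rewrite -big_split big1// => i _ /=.
  by rewrite (@diff_val _ _ _ _ _ _ _ (DC i)) mulrNN addNr.
- by case=> [e|]; rewrite oppr_ge0 /=.
- by case=> [e|]; rewrite oppr_le0 /=.
- by move=> i; rewrite mulrNN mulrC KKT_Xi_slack.
Qed.

End Duality.

(** The dual KKT claim is confined to nonzero determinant, the domain on which the canonical dual
    function has its closed form. *)
Theorem theorem1 (R : realType) (d m n : nat) (M : fe_model R d m n)
    (u : 'cV[R]_m) (hu : fe_adm M u) (Vc : R) (hVc : 0 < Vc)
    (rho : 'rV[R]_n) (zeta : 'rV[R]_n * R) :
  let a := fe_a M in
  let c := fe_c M u in
  KKT_Xi c a Vc rho zeta ->
  [/\ KKT_Phi c a Vc rho,
      (\det (Gmx zeta) != 0 -> KKT_Phid c a Vc zeta),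
      Phi c a Vc rho = Xi c a Vc rho zeta
    & Xi c a Vc rho zeta = Phid c a Vc zeta].
Proof.
move=> a c K; have [S Z L _ _] := K; split.
- exact: KKT_Xi_KKT_Phi K.
- by move=> G0; exact: KKT_Xi_KKT_Phid G0 K.
(* Feasibility makes both indicators zero, so each side reduces to [Pu c rho]. *)
- rewrite /Phi /Xi Psi_starE /lagr (KKT_Xi_pairing _ _ _ _ _ K) addr0.
  by rewrite /Psi /indicator !mem_set// oppe0.
(* All stationary points of [lagr] at [zeta] share one value, so this covers singular [Gmx zeta] as
   well. *)
- by rewrite /Xi /Phid (stat_val S).
Qed.
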